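(* Let $A=\Bbbk Q/I$ be a quadratic monomial algebra and let $R$ be a minimal set of relations such that $I=\langle R\rangle$. Then $A$ is a UMP algebra if and only if $A$ is a special multiserial algebra.
   Context: Setting: $\Bbbk$ is an algebraically closed field, $Q$ is a finite connected quiver with arrow set $Q_1$ and source and target maps $s,t$; $I$ is an admissible ideal of $\Bbbk Q$, and $A=\Bbbk Q/I$ (finite-dimensional). Paths are composed from left to right: $\alpha\beta$ is a path when $t(\alpha)=s(\beta)$ (products of non-composable paths are $0$). $A$ is quadratic monomial if $I$ is generated by paths of length two. UMP algebras: for a path $\mathfrak m$ of $Q$, $\mathfrak m+I$ is a maximal path of $A$ if $\mathfrak m\notin I$ and $\alpha\mathfrak m\in I$ and $\mathfrak m\alpha\in I$ for every arrow $\alpha\in Q_1$. Two paths of $Q$ are disjoint if they have no common nontrivial subpath. Two maximal paths $\mathfrak m+I$, $\mathfrak m'+I$ are disjoint if any path $w$ of $Q$ representing $\mathfrak m+I$ and any path $w'$ of $Q$ representing $\mathfrak m'+I$ are disjoint. $A$ is a UMP algebra if any two different maximal paths of $A$ are disjoint. $A$ is special multiserial if for every arrow $\alpha\in Q_1$ there is at most one arrow $\beta\in Q_1$ such that $\alpha\beta\notin I$ and at most one arrow $\gamma\in Q_1$ such that $\gamma\alpha\notin I$. *)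

(* Defs.v *)
From HB Require Import structures.
From mathcomp Require Import all_boot all_algebra finmap.
From mathcomp Require Import monalg.

Set Implicit Arguments.
Unset Strict Implicit.
Unset Printing Implicit Defensive.

Import GRing.Theory.
Local Open Scope ring_scope.

Record quiver := Quiver {
  vertex : finType;
  arrow : finType;
  source : arrow -> vertex;
  target : arrow -> vertex
}.

Section Paths.
Variable Q : quiver.

Definition adjacent (i j : vertex Q) : bool :=
  [exists a : arrow Q, (source a == i) && (target a == j)
                    || (source a == j) && (target a == i)].

Definition connected_quiver : Prop :=
  (0 < #|vertex Q|)%N /\ forall i j, connect adjacent i j.

(* [walk i l]: the arrows in [l], read from left to right, can be travelled
   one after the other starting at the vertex [i]. *)
Fixpoint walk (i : vertex Q) (l : seq (arrow Q)) : bool :=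
  if l is a :: l' then (source a == i) && walk (target a) l' else true.

(* The start vertex is kept to distinguish the trivial paths. *)
Record qpath := QPath {
  qpath_val : vertex Q * seq (arrow Q);
  _ : walk qpath_val.1 qpath_val.2
}.

HB.instance Definition _ := [isSub for qpath_val].
HB.instance Definition _ := [Countable of qpath by <:].

Definition arrows (p : qpath) : seq (arrow Q) := (val p).2.
Definition psource (p : qpath) : vertex Q := (val p).1.
Definition ptarget (p : qpath) : vertex Q :=
  last (psource p) (map (@target Q) (arrows p)).
Definition plength (p : qpath) : nat := size (arrows p).

Definition trivial_path (i : vertex Q) : qpath := @QPath (i, [::]) isT.

Lemma arrow_walk (a : arrow Q) : walk (source a) [:: a].
Proof. by rewrite /= eqxx. Qed.

Definition arrow_path (a : arrow Q) : qpath :=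
  @QPath (source a, [:: a]) (arrow_walk a).

Lemma walk_cat i l1 l2 :
  walk i (l1 ++ l2) = walk i l1 && walk (last i (map (@target Q) l1)) l2.
Proof. by elim: l1 i => [|a l1 IH] i //=; rewrite IH andbA. Qed.

Definition pcat (p q : qpath) : option qpath :=
  if ptarget p == psource q then insub (psource p, arrows p ++ arrows q)
  else None.

Lemma pcatP p q : ptarget p = psource q ->
  {r | pcat p q = Some r & val r = (psource p, arrows p ++ arrows q)}.
Proof.
move=> pq; rewrite /pcat pq eqxx.
case: insubP => [r _ rE|]; first by exists r.
case: p q pq => [[i l] Hp] [[j l'] Hq] /= pq /negP[].
by rewrite walk_cat; apply/andP; split=> //; move: pq; rewrite /ptarget /= => ->.
Qed.

Lemma pcatN p q : ptarget p != psource q -> pcat p q = None.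
Proof. by rewrite /pcat => /negbTE->. Qed.

Definition subpath (u w : qpath) : Prop :=
  exists p q r, pcat p u = Some r /\ pcat r q = Some w.

Definition disjoint_paths (w w' : qpath) : Prop :=
  forall u, (0 < plength u)%N -> ~ (subpath u w /\ subpath u w').

End Paths.

Section LinearExtension.
Variables (k : nzRingType) (K : choiceType) (V : lmodType k).
Implicit Types (h : K -> V) (x y : {malg k[K]}).

Definition linext h x : V := \sum_(p <- msupp x) x@_p *: h p.

Lemma linextw h x (d : {fset K}) : (msupp x `<=` d)%fset ->
  linext h x = \sum_(p <- d) x@_p *: h p.
Proof.
move=> le; rewrite /linext; apply: big_fset_incl => // p _ px.
by rewrite mcoeff_outdom // scale0r.
Qed.

Lemma linextU h p : linext h << p >> = h p.
Proof.
by rewrite /linext msuppU oner_eq0 big_seq_fset1 mcoeffUU scale1r.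
Qed.

Lemma linext_is_linear h : linear (linext h).
Proof.
move=> c x y; set z := c *: x + y.
set d := (msupp z `|` (msupp x `|` msupp y))%fset.
have dz : (msupp z `<=` d)%fset by rewrite fsubsetUl.
have dx : (msupp x `<=` d)%fset by rewrite /d fsetUCA fsubsetUl.
have dy : (msupp y `<=` d)%fset by rewrite /d fsetUA fsubsetUr.
rewrite (linextw _ dz) (linextw _ dx) (linextw _ dy).
rewrite scaler_sumr -big_split /=; apply: eq_bigr => p _.
by rewrite mcoeffD mcoeffZ scalerDl scalerA.
Qed.

HB.instance Definition _ h :=
  GRing.isLinear.Build k {malg k[K]} V *:%R (linext h) (linext_is_linear h).

Lemma eq_linext h1 h2 x : h1 =1 h2 -> linext h1 x = linext h2 x.
Proof. by move=> e; apply: eq_bigr => p _; rewrite e. Qed.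

End LinearExtension.

Lemma malg_linE (k : nzRingType) (K : choiceType) (x : {malg k[K]}) :
  x = linext (fun p => << p >>) x.
Proof.
rewrite {1}[x]monalgE; apply: eq_bigr => p _.
by apply/malgP => q; rewrite mcoeffZ !mcoeffU mulrnAr mulr1.
Qed.

Definition path_algebra (k : comNzRingType) (Q : quiver) := {malg k[qpath Q]}.

(* Locked because unification would otherwise unfold the basis elements down
   to finite maps. *)
HB.lock Definition of_path (k : comNzRingType) (Q : quiver) (p : qpath Q)
  : path_algebra k Q := << p >>.
Canonical of_path_unlockable := Unlockable of_path.unlock.

Section PathAlgebra.
Variables (k : comNzRingType) (Q : quiver).
Local Notation kQ := (path_algebra k Q).
Local Notation of_path := (of_path k).
Implicit Types (p q r : qpath Q) (x y z : kQ).

HB.instance Definition _ := GRing.Lmodule.on kQ.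

Definition path_mul p q : kQ := if pcat p q is Some r then of_path r else 0.

Definition pa_mul x y : kQ :=
  linext (fun p => linext (path_mul p) y) x.

Definition pa_one : kQ := \sum_(i : vertex Q) of_path (trivial_path i).

Lemma pa_mulUU p q : pa_mul (of_path p) (of_path q) = path_mul p q.
Proof. by rewrite /pa_mul unlock !linextU. Qed.

Definition pa_mulr y x := pa_mul x y.

Lemma pa_mul_linl y : linear (pa_mulr y).
Proof. by move=> c x x'; rewrite /pa_mulr /pa_mul linearP. Qed.

Lemma pa_mul_linr x : linear (pa_mul x).
Proof.
move=> c y y'; rewrite /pa_mul /linext scaler_sumr -big_split.
apply: eq_bigr => p _.
by rewrite -!/(linext (path_mul p) _) linearP scalerDr !scalerA mulrC.
Qed.

HB.instance Definition _ y :=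
  GRing.isLinear.Build k kQ kQ *:%R (pa_mulr y) (pa_mul_linl y).
HB.instance Definition _ x :=
  GRing.isLinear.Build k kQ kQ *:%R (pa_mul x) (pa_mul_linr x).

Lemma pa_mul0x y : pa_mul 0 y = 0.
Proof. exact: (linear0 (pa_mulr y)). Qed.

Lemma pa_mulx0 x : pa_mul x 0 = 0.
Proof. exact: (linear0 (pa_mul x)). Qed.

Lemma pa_mul_suml (I : finType) (F : I -> kQ) y :
  pa_mul (\sum_i F i) y = \sum_i pa_mul (F i) y.
Proof. exact: (linear_sum (pa_mulr y)). Qed.

Lemma pa_mul_sumr (I : finType) (F : I -> kQ) x :
  pa_mul x (\sum_i F i) = \sum_i pa_mul x (F i).
Proof. exact: (linear_sum (pa_mul x)). Qed.

Lemma pa_ind (f g : {linear kQ -> kQ}) :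
  (forall p, f (of_path p) = g (of_path p)) -> f =1 g.
Proof.
move=> fg x; rewrite [x]malg_linE /linext !linear_sum /=.
by apply: eq_bigr => p _; rewrite !linearZ /=; move: (fg p); rewrite unlock => ->.
Qed.

Lemma pcatA p q r :
  obind (fun u => pcat u r) (pcat p q) = obind (pcat p) (pcat q r).
Proof.
have [pq|npq] := eqVneq (ptarget p) (psource q); last first.
  rewrite (pcatN npq) /=.
  have [qr|nqr] := eqVneq (ptarget q) (psource r); last by rewrite (pcatN nqr).
  have [v -> vE] := pcatP qr; rewrite /= pcatN //.
  by rewrite /psource vE -/(psource q).
have [u -> uE] := pcatP pq; rewrite /=.
have tu : ptarget u = ptarget q.
  by rewrite /ptarget {1}/psource /arrows uE /= map_cat last_cat -/(ptarget p) pq.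
have [qr|nqr] := eqVneq (ptarget q) (psource r); last first.
  by rewrite (pcatN nqr) pcatN ?tu.
have [v -> vE] := pcatP qr; rewrite /=.
have pv : ptarget p = psource v by rewrite pq /psource vE.
have ur : ptarget u = psource r by rewrite tu.
have [w -> wE] := pcatP pv; have [w' -> wE'] := pcatP ur.
congr Some; apply: val_inj.
by rewrite wE wE' /psource /arrows uE vE /= catA.
Qed.

Lemma pa_mulA : associative pa_mul.
Proof.
move=> x y z.
have := @pa_ind (pa_mulr (pa_mul y z)) (pa_mulr z \o pa_mulr y).
apply=> p /= {x}.
have := @pa_ind (pa_mul (of_path p) \o pa_mulr z)
                (pa_mulr z \o pa_mul (of_path p)).
apply=> q /= {y}.
have := @pa_ind (pa_mul (of_path p) \o pa_mul (of_path q))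
                (pa_mul (pa_mul (of_path p) (of_path q))).
apply=> r /= {z}; rewrite /pa_mulr (pa_mulUU q r) (pa_mulUU p q) /path_mul.
have := pcatA p q r.
case: (pcat p q) => [u|]; case: (pcat q r) => [v|] /= e.
- by rewrite (pa_mulUU p v) (pa_mulUU u r) /path_mul e.
- by rewrite (pa_mulUU u r) /path_mul e pa_mulx0.
- by rewrite (pa_mulUU p v) /path_mul -e pa_mul0x.
- by rewrite pa_mulx0 pa_mul0x.
Qed.

Lemma pa_mul1x : left_id pa_one pa_mul.
Proof.
move=> x; have := @pa_ind (pa_mul pa_one) idfun; apply=> p /= {x}.
rewrite /pa_one pa_mul_suml (bigD1 (psource p)) //=.
rewrite big1 ?addr0 => [|i ni]; rewrite pa_mulUU /path_mul.
  have /pcatP[r -> rE] : ptarget (trivial_path (psource p)) = psource p by [].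
  by congr of_path; apply: val_inj; rewrite rE [RHS]surjective_pairing.
by rewrite /pcat (_ : ptarget _ = i) // (negbTE ni).
Qed.

Lemma pa_mulx1 : right_id pa_one pa_mul.
Proof.
move=> x; have := @pa_ind (pa_mulr pa_one) idfun; apply=> p /= {x}.
rewrite /pa_mulr /pa_one pa_mul_sumr (bigD1 (ptarget p)) //=.
rewrite big1 ?addr0 => [|i ni]; rewrite pa_mulUU /path_mul.
  have /pcatP[r -> rE] : ptarget p = psource (trivial_path (ptarget p)) by [].
  by congr of_path; apply: val_inj; rewrite rE cats0 [RHS]surjective_pairing.
by rewrite /pcat (_ : psource (trivial_path i) = i) // eq_sym (negbTE ni).
Qed.

Lemma pa_mulDl : left_distributive pa_mul +%R.
Proof. move=> x y z; exact: (linearD (pa_mulr z)). Qed.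

Lemma pa_mulDr : right_distributive pa_mul +%R.
Proof. move=> x y z; exact: (linearD (pa_mul x)). Qed.

HB.instance Definition _ := GRing.Zmodule_isPzRing.Build kQ
  pa_mulA pa_mul1x pa_mulx1 pa_mulDl pa_mulDr.

Lemma of_pathM p q : of_path p * of_path q = path_mul p q.
Proof. exact: pa_mulUU. Qed.

Lemma pa_scaleAl (c : k) x y : c *: (x * y) = (c *: x) * y.
Proof. exact: esym (linearZ_LR (pa_mulr y) c x). Qed.

Lemma pa_scaleAr (c : k) x y : c *: (x * y) = x * (c *: y).
Proof. exact: esym (linearZ_LR (pa_mul x) c y). Qed.

End PathAlgebra.

Section Ideals.
Variable R : pzRingType.
Implicit Types I J S : R -> Prop.

Definition is_ideal I : Prop :=
  [/\ I 0,
      forall x y, I x -> I y -> I (x + y),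
      forall a x, I x -> I (a * x)
    & forall a x, I x -> I (x * a)].

Definition subset_of S S' : Prop := forall x, S x -> S' x.

Definition ideal_gen S : R -> Prop :=
  fun x => forall J, is_ideal J -> subset_of S J -> J x.

Definition generates S I : Prop := forall x, I x <-> ideal_gen S x.

Definition ideal_prod I J : R -> Prop :=
  ideal_gen (fun z => exists x y, [/\ I x, J y & z = x * y]).

Fixpoint ideal_pow I (n : nat) : R -> Prop :=
  if n is n'.+1 then ideal_prod (ideal_pow I n') I else fun=> True.

End Ideals.

Section BoundQuiverAlgebras.
Variables (k : comNzRingType) (Q : quiver).
Local Notation kQ := (path_algebra k Q).
Local Notation of_path := (of_path k).
Implicit Types (I S : kQ -> Prop) (m w : qpath Q) (a b c : arrow Q).

Definition of_arrow a : kQ := of_path (arrow_path a).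

Definition arrow_ideal : kQ -> Prop :=
  ideal_gen (fun x => exists a, x = of_arrow a).

Definition admissible I : Prop :=
  is_ideal I /\
  exists2 n, (2 <= n)%N & subset_of (ideal_pow arrow_ideal n) I
                       /\ subset_of I (ideal_pow arrow_ideal 2%N).

Definition quadratic_monomial I : Prop :=
  exists2 P : qpath Q -> Prop, forall p, P p -> plength p = 2%N
    & generates (fun x => exists2 p, P p & x = of_path p) I.

Definition is_relation (x : kQ) : Prop :=
  x != 0 /\ exists i j, forall p, p \in msupp x ->
    [/\ psource p = i, ptarget p = j & (2 <= plength p)%N].

Definition minimal_relations S I : Prop :=
  [/\ subset_of S is_relation,
      generates S I
    & forall S', subset_of S' S -> generates S' I -> subset_of S S'].

(* The residue classes [w + I] and [m + I] in [kQ / I] are equal. *)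
Definition represents I w m : Prop := I (of_path w - of_path m).

(* A maximal path [m + I] of [kQ / I] is handled through a path [m]
   representing it. *)
Definition maximal_path I m : Prop :=
  [/\ ~ I (of_path m),
      forall a, I (of_arrow a * of_path m)
    & forall a, I (of_path m * of_arrow a)].

Definition disjoint_classes I m m' : Prop :=
  forall w w', represents I w m -> represents I w' m' -> disjoint_paths w w'.

Definition UMP I : Prop :=
  forall m m', maximal_path I m -> maximal_path I m' ->
    ~ represents I m m' -> disjoint_classes I m m'.

Definition special_multiserial I : Prop :=
  forall a,
    (forall b b', ~ I (of_arrow a * of_arrow b) ->
                  ~ I (of_arrow a * of_arrow b') -> b = b') /\
    (forall c c', ~ I (of_arrow c * of_arrow a) ->
                  ~ I (of_arrow c' * of_arrow a) -> c = c').

End BoundQuiverAlgebras.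

(* Main.v *)
(** A path lies in a quadratic monomial ideal [I] exactly when two of its
consecutive arrows have their product in [I], so the nonzero paths of [A] are
the chains of the relation [ab \notin I] on arrows, and two paths of which one
is nonzero represent the same class only if they are equal. If this relation
is functional in both directions, a maximal chain is determined by any of its
arrows. Conversely, admissibility bounds the length of chains; hence chains
extend to maximal ones, and no chain repeats an arrow, since otherwise going
around the resulting cycle would give arbitrarily long chains. Two distinct
successors [b], [b'] of an arrow [a] would then give distinct maximal paths
through [ab] and [ab'], both containing [a]. *)

Require Import Defs.
From mathcomp Require Import all_boot all_algebra.
From mathcomp Require Import finmap monalg boolp.

Set Implicit Arguments.
Unset Strict Implicit.
Unset Printing Implicit Defensive.

Import GRing.Theory.

(** * Maximal chains of a relation *)

Section Chains.
Variable T : eqType.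
Implicit Types (e : rel T) (a b c : T) (s l : seq T).

(** Failure on the empty sequence makes every maximal chain nonempty, so that trivial paths never
    arise from one. *)
Definition dead_end e s :=
  if s is a :: l then forall b, ~~ e (last a l) b else False.

Definition maxchain e s :=
  [/\ sorted e s, dead_end e s & dead_end (fun x y => e y x) (rev s)].

Definition functional e := forall a b b', e a b -> e a b' -> b = b'.

Lemma dead_end_cat e s a l : dead_end e (s ++ a :: l) <-> dead_end e (a :: l).
Proof. by case: s => [|c s] //=; rewrite last_cat. Qed.

Lemma dead_endE e s : s != [::] ->
  dead_end e s <-> forall b, ~~ e (last b s) b.
Proof. by case: s. Qed.

Lemma dead_end_revE e s : s != [::] ->
  dead_end (fun x y => e y x) (rev s) <-> forall b, ~~ e b (head b s).
Proof.
move=> s0; rewrite dead_endE -?size_eq0 ?size_rev ?size_eq0 //.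
case: s s0 => // a l _.
by split=> d b; have := d b; rewrite rev_cons last_rcons.
Qed.

(** Each successor is forced, and neither path can stop where the other continues, since its end has
    no successor. *)
Lemma dead_path_inj e a l l' : functional e ->
  path e a l -> path e a l' -> dead_end e (a :: l) -> dead_end e (a :: l') ->
  l = l'.
Proof.
move=> fe; elim: l l' a => [|b l IH] [|b' l'] a //=.
- by move=> _ /andP[eb _] /(_ b'); rewrite eb.
- by move=> /andP[eb _] _ _ /(_ b); rewrite eb.
move=> /andP[eb pl] /andP[eb' pl'] dl dl'.
by move: eb' pl' dl' => /(fe _ _ _ eb) <- pl' dl'; rewrite (IH l' b).
Qed.

(** Both chains are split at [a]: what follows is forced by [dead_path_inj], and what precedes by
    the same lemma for the converse relation on the reversed prefixes. *)
Lemma maxchain_inj e s s' a :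
  functional e -> functional (fun x y => e y x) ->
  maxchain e s -> maxchain e s' -> a \in s -> a \in s' -> s = s'.
Proof.
move=> fe fe' [+ + +] [+ + +] sa sa'.
case/splitPr: sa => l1 l2; case/splitPr: sa' => l1' l2'.
have split_sorted l l' : sorted e (l ++ a :: l') ->
    path e a l' /\ path (fun x y => e y x) a (rev l).
  rewrite sorted_cat_cons => /andP[pl pl']; split=> //.
  by rewrite -rev_sorted rev_rcons in pl.
have rev_mid l l' : rev (l ++ a :: l') = rev l' ++ a :: rev l.
  by rewrite rev_cat rev_cons cat_rcons.
rewrite !rev_mid !dead_end_cat => /split_sorted[p2 p1] d2 d1.
move=> /split_sorted[p2' p1'] d2' d1'.
rewrite (dead_path_inj fe p2 p2' d2 d2').
by rewrite -(revK l1) (dead_path_inj fe' p1 p1' d1 d1') revK.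
Qed.

(** * Relations with chains of bounded length *)

Definition bounded_chains e := exists n, forall s, sorted e s -> (size s < n)%N.

Lemma bounded_chains_rev e :
  bounded_chains e -> bounded_chains (fun x y => e y x).
Proof.
by case=> n bn; exists n => s ss; rewrite -size_rev bn // rev_sorted.
Qed.

Lemma dead_end_extend e s : bounded_chains e -> sorted e s -> s != [::] ->
  exists l, sorted e (s ++ l) /\ dead_end e (s ++ l).
Proof.
case=> n bn; have [m] := ubnP (n - size s); elim: m s => // m IH s lt ss s0.
have [[b eb]|nb] := pselect (exists b, sorted e (rcons s b)).
  have [||l] := IH _ _ eb; first 1 last.
  - by case: (s).
  - by rewrite cat_rcons; exists (b :: l).
  (* The measure [n - size s] drops because the chain [rcons s b] is itself shorter than [n]. *)
  - by have := bn _ eb; rewrite size_rcons => lts; move: lt; rewrite ltnS;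
      apply: leq_trans; rewrite ltn_sub2l // ltnW.
exists [::]; rewrite cats0; split=> //.
case: s s0 ss nb {lt} => //= a l _ pl nb b; apply/negP => eb.
by case: nb; exists b; rewrite rcons_path pl.
Qed.

Lemma maxchain_extend e s : bounded_chains e -> sorted e s -> s != [::] ->
  exists l l', maxchain e (l ++ s ++ l').
Proof.
move=> be ss s0; have [l' [sl dl]] := dead_end_extend be ss s0.
have be' := bounded_chains_rev be.
have [||l [sr dr]] := dead_end_extend (s := rev (s ++ l')) be'.
- by rewrite rev_sorted.
- by rewrite -size_eq0 size_rev size_cat addn_eq0 size_eq0 (negbTE s0).
exists (rev l), l'; split.
- by rewrite -rev_sorted rev_cat revK.
(* Prolonging on the left does not change the last entry. *)
- by case: (s ++ l') dl => // a r /dead_end_cat; apply.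
- by rewrite rev_cat revK.
Qed.

(** A chain returning to [a] closes a loop, and iterating the loop breaks the bound. *)
Lemma bounded_chains_acyclic e a l :
  bounded_chains e -> path e a l -> a \notin l.
Proof.
case=> n bn pl; apply/negP => al; case/splitPr: al pl => l1 l2.
rewrite -cat_rcons cat_path => /andP[pl _].
pose loop m := flatten (nseq m (rcons l1 a)).
have ploop m : path e a (loop m).
  by elim: m => //= m IH; rewrite cat_path pl last_rcons.
have sloop m : (m <= size (loop m))%N.
  elim: m => //= m IH; rewrite size_cat size_rcons addSn ltnS.
  exact: leq_trans IH (leq_addl _ _).
by have := bn (a :: loop n) (ploop n); rewrite /= ltnNge ltnW // ltnS.
Qed.

Lemma bounded_chains_uniq e s : bounded_chains e -> sorted e s -> uniq s.
Proof.
move=> be; elim: s => //= a l IH pl.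
by rewrite (bounded_chains_acyclic be pl) IH // (path_sorted pl).
Qed.

(** Without repetitions, [s] and [a] determine the entry after [a]; two decompositions of one chain
    can thus be compared. *)
Lemma uniq_succ s l a b l' : uniq s -> s = l ++ a :: b :: l' ->
  nth b s (index a s).+1 = b.
Proof.
move=> us sE; move: us; rewrite sE cat_uniq /= => /and3P[_ /norP[al _] _].
rewrite index_cat (negbTE al) /= eqxx addn0 nth_cat ltnNge leqnSn /=.
by rewrite subSn // subnn.
Qed.

Lemma maxchain_functional e : bounded_chains e ->
  (forall s s' a, maxchain e s -> maxchain e s' -> a \in s -> a \in s' ->
    s = s') ->
  functional e.
Proof.
move=> be inj a b b' eb eb'.
have [||l1 [l2 m]] := @maxchain_extend e [:: a; b] be; rewrite /= ?eb //.
have [||l1' [l2' m']] := @maxchain_extend e [:: a; b'] be; rewrite /= ?eb' //.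
have E : l1 ++ [:: a, b & l2] = l1' ++ [:: a, b' & l2'].
  by apply: (inj _ _ a) => //; rewrite mem_cat mem_head orbT.
case: (m) => /(bounded_chains_uniq be) us _ _.
(* The default may be changed to [b'] since the index is in range; the second decomposition then
   evaluates the same entry to [b']. *)
have := uniq_succ us erefl; rewrite (set_nth_default b') ?(uniq_succ us E) //.
move: us; rewrite cat_uniq => /and3P[_ /norP[/= al _] _].
by rewrite index_cat (negbTE al) /= eqxx addn0 size_cat /= !addnS !ltnS
  leq_addr.
Qed.

Lemma maxchain_rev e s : maxchain (fun x y => e y x) s <-> maxchain e (rev s).
Proof.
by rewrite /maxchain revK rev_sorted; split=> -[ss d d'].
Qed.

(** Uniqueness of predecessors is uniqueness of successors for the converse relation, whose maximal
    chains are the reversed ones. *)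
Lemma maxchain_inj_functional e : bounded_chains e ->
  (forall s s' a, maxchain e s -> maxchain e s' -> a \in s -> a \in s' ->
    s = s') <->
  functional e /\ functional (fun x y => e y x).
Proof.
move=> be; split=> [inj|[fe fe'] s s' a ms ms']; last first.
  exact: (maxchain_inj fe fe' ms ms').
split; apply: maxchain_functional => //; first exact: bounded_chains_rev.
move=> s s' a /maxchain_rev ms /maxchain_rev ms'.
rewrite -mem_rev -(mem_rev s') => sa sa'.
by apply: (can_inj revK); apply: inj sa sa'.
Qed.

End Chains.

Local Open Scope ring_scope.

(** * Paths and their arrow sequences *)

Section Paths.
Variable Q : quiver.
Implicit Types (p q r u w : qpath Q) (a b : arrow Q).

Lemma pcat_arrows p q r : pcat p q = Some r -> arrows r = arrows p ++ arrows q.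
Proof.
have [/pcatP[r' -> rE] [<-]|/pcatN->//] := eqVneq (ptarget p) (psource q).
by rewrite /arrows rE.
Qed.

Lemma subpath_arrows u w : subpath u w -> {subset arrows u <= arrows w}.
Proof.
case=> p [q [r [/pcat_arrows rE /pcat_arrows wE]]] a au.
by rewrite wE rE !mem_cat au orbT.
Qed.

(** Together with [subpath_arrows], this reduces disjointness of paths to the absence of a common
    arrow. *)
Lemma subpath_arrow a w : a \in arrows w -> subpath (arrow_path a) w.
Proof.
case: w => -[i s] /= ws; rewrite /arrows /= => sa.
case/splitPr: sa ws => l l' ws.
have := ws; rewrite walk_cat /= => /and3P[wl /eqP al wl'].
pose p : qpath Q := @QPath Q (i, l) wl.
pose q : qpath Q := @QPath Q (target a, l') wl'.
have pa : ptarget p = psource (arrow_path a) by rewrite /psource /= al.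
have [r rE vr] := pcatP pa.
have rq : ptarget r = psource q.
  by rewrite /ptarget /arrows vr /= map_cat last_cat.
have [w wE vw] := pcatP rq.
exists p, q, r; split=> //; rewrite wE; congr Some; apply: val_inj.
by rewrite vw /psource /arrows vr /= -catA.
Qed.

(** A first arrow fixes the start vertex, whereas all trivial paths share the empty sequence. *)
Lemma arrows_inj p q : arrows p != [::] -> arrows p = arrows q -> p = q.
Proof.
case: p q => -[i s] ws [[j s'] ws']; rewrite /arrows /= => s0 E.
apply: val_inj => /=; move: ws ws'; rewrite -E /=.
by case: s s0 {E} => //= a s _ /andP[/eqP <- _] /andP[/eqP <- _].
Qed.

End Paths.

(** * Products of arrows and powers of the arrow ideal *)

Section QuadraticMonomial.
Variables (k : comNzRingType) (Q : quiver) (I : path_algebra k Q -> Prop).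
Implicit Types (p q r u w m : qpath Q) (a b c : arrow Q).

(** Classical reflection makes the relation boolean, so that [sorted] applies to it. *)
Definition nonzero_pair a b := `[< ~ I (of_arrow k a * of_arrow k b) >].

Lemma nonzero_pairN a b :
  ~~ nonzero_pair a b -> I (of_arrow k a * of_arrow k b).
Proof. by move/asboolPn/contrapT. Qed.

Lemma of_path_eq_cat p q r : ptarget p = psource q -> psource r = psource p ->
  arrows r = arrows p ++ arrows q -> of_path k r = of_path k p * of_path k q.
Proof.
move=> pq rp rE; rewrite of_pathM /path_mul.
have [r' -> r'E] := pcatP pq; congr of_path; apply: val_inj.
by rewrite r'E -rp -rE [LHS]surjective_pairing.
Qed.

Lemma of_path_cons p a l : arrows p = a :: l -> exists2 q, arrows q = l &
  [/\ psource p = source a, psource q = target a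
    & of_path k p = of_arrow k a * of_path k q].
Proof.
case: p => -[i s] ws; rewrite /arrows /= => sE; subst s.
have /andP[/eqP ia wl] := ws.
exists (@QPath Q (target a, l) wl) => //; split=> //.
exact: of_path_eq_cat.
Qed.

Lemma of_arrowM_neq a b : target a != source b ->
  of_arrow k a * of_arrow k b = 0.
Proof. by move=> ab; rewrite of_pathM /path_mul pcatN. Qed.

(** The last arrow is split off because [ideal_pow] takes its new factor on the right. *)
Lemma of_path_ideal_pow p n : (n <= plength p)%N ->
  ideal_pow (@arrow_ideal k Q) n (of_path k p).
Proof.
elim: n p => //= n IH p np.
case: p np => -[i s]; elim/last_ind: s => [|s a _] ws //.
rewrite /plength /= /arrows /= size_rcons ltnS => ns.
have := ws; rewrite /= -{1}cats1 walk_cat /= andbT => /andP[wl /eqP al].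
move=> J Jid; apply; exists (of_path k (@QPath Q (i, s) wl)), (of_arrow k a).
split; first exact: IH.
  by move=> J' _; apply; exists a.
by apply: of_path_eq_cat => //; rewrite /arrows /= cats1.
Qed.

(** * Membership of paths in a quadratic monomial ideal *)

Section Monomial.
Hypotheses (Iideal : is_ideal I) (Iquad : quadratic_monomial I).

(** The span of the paths with two consecutive arrows whose product is in [I]; it serves as an ideal
    bounding [I] from above. *)
Definition zero_supp (x : path_algebra k Q) :=
  forall q, q \in msupp x -> ~~ sorted nonzero_pair (arrows q).

Lemma zero_supp_path p : ~~ sorted nonzero_pair (arrows p) ->
  zero_supp (of_path k p).
Proof.
by move=> np q; rewrite unlock msuppU oner_eq0 inE => /eqP->.
Qed.

Lemma zero_supp0 : zero_supp 0.
Proof. by move=> q; rewrite msupp0 in_fset0. Qed.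

Lemma zero_suppD x y : zero_supp x -> zero_supp y -> zero_supp (x + y).
Proof.
move=> zx zy q /(fsubsetP (msuppD_le _ _)).
by rewrite in_fsetU => /orP[/zx|/zy].
Qed.

Lemma zero_suppZ (t : k) x : zero_supp x -> zero_supp (t *: x).
Proof. by move=> zx q /(fsubsetP (msuppZ_le _ _)) /zx. Qed.

Lemma zero_supp_linext (h : qpath Q -> path_algebra k Q) x :
  (forall p, p \in msupp x -> zero_supp (h p)) -> zero_supp (linext h x).
Proof.
move=> zh; rewrite /linext big_seq.
apply: big_ind => [||p /zh zp]; [exact: zero_supp0|exact: zero_suppD|].
exact: zero_suppZ.
Qed.

(** A pair of consecutive arrows of either factor survives in the concatenation. *)
Lemma zero_supp_mul p q :
  ~~ (sorted nonzero_pair (arrows p) && sorted nonzero_pair (arrows q)) ->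
  zero_supp (path_mul k p q).
Proof.
rewrite /path_mul; case E: (pcat p q) => [r|] npq; last exact: zero_supp0.
apply: zero_supp_path; apply: contra npq.
by rewrite (pcat_arrows E) => /cat_sorted2[-> ->].
Qed.

Lemma zero_supp_ideal : is_ideal zero_supp.
Proof.
split; [exact: zero_supp0|exact: zero_suppD| |] => a x zx.
  apply: zero_supp_linext => p _; apply: zero_supp_linext => q /zx nq.
  by apply: zero_supp_mul; rewrite negb_and nq orbT.
apply: zero_supp_linext => p /zx np; apply: zero_supp_linext => q _.
by apply: zero_supp_mul; rewrite negb_and np.
Qed.

(** [I] is the least ideal containing its generators, and each generator is the product of its own
    two arrows. *)
Lemma mem_zero_supp x : I x -> zero_supp x.
Proof.
case: Iquad => P P2 genI Ix; apply: (genI x).1 => // {Ix}.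
  exact: zero_supp_ideal.
move=> _ [p Pp ->]; apply: zero_supp_path.
have Ip : I (of_path k p) by apply/genI => J _; apply; exists p.
have := P2 p Pp; rewrite /plength.
case E : (arrows p) => [|a [|b [|]]] //= _; rewrite andbT.
apply/asboolPn => -[].
have [q qE [_ _ pq]] := of_path_cons E.
have [r rE [bq rb qr]] := of_path_cons qE.
have -> : of_arrow k a * of_arrow k b = of_path k p; last by [].
rewrite pq; congr (_ * of_path k _); apply: arrows_inj => //.
Qed.

Lemma mem_of_path p : I (of_path k p) <-> ~~ sorted nonzero_pair (arrows p).
Proof.
split=> [/mem_zero_supp|]; first by apply; rewrite unlock msuppU oner_eq0 inE.
case: Iideal => _ _ Il Ir.
have [s sE] : exists s, s = arrows p by exists (arrows p).
rewrite -sE; elim: s p sE => // a s IH p /esym/of_path_cons[q qE [_ _ ->]].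
case: s IH qE => //= b l IH qE; rewrite negb_and => /orP[nab|np]; last first.
  exact/Il/IH.
have [r _ [_ _ ->]] := of_path_cons qE.
by rewrite mulrA; apply/Ir/nonzero_pairN.
Qed.

Lemma nonzero_pair_composable a b : nonzero_pair a b -> target a = source b.
Proof.
move=> /asboolP ab; apply/eqP/negP => /negP /of_arrowM_neq E; apply: ab.
by rewrite E; case: Iideal.
Qed.

Lemma chain_path s : s != [::] -> sorted nonzero_pair s ->
  exists p, arrows p = s.
Proof.
case: s => // a l _ /= pl.
have wl : walk (source a) (a :: l).
  elim: l a pl => [|b l IH] a /=; rewrite eqxx //=.
  by case/andP=> /nonzero_pair_composable-> /IH.
by exists (@QPath Q (source a, a :: l) wl).
Qed.

(** Non-composable factors fit too: their product is [0], while a chain would force them to be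
    composable. *)
Lemma mem_mul_of_path p q : arrows p != [::] -> arrows q != [::] ->
  I (of_path k p * of_path k q) <->
  ~~ sorted nonzero_pair (arrows p ++ arrows q).
Proof.
move=> p0 q0; rewrite of_pathM /path_mul; case E: (pcat p q) => [r|].
  by rewrite -(pcat_arrows E); exact: mem_of_path.
split=> _; last by case: Iideal.
apply/negP => s; have [w wE] : exists w, arrows w = arrows p ++ arrows q.
  by apply: chain_path => //; case: (arrows p) p0.
move: E; suff /pcatP[r -> _] : ptarget p = psource q by [].
case: p q w p0 q0 wE {s} => -[i l] wp [[j l'] wq] [[i' l''] ww] /=.
rewrite /ptarget /psource /arrows /= => p0 q0 E.
move: ww; rewrite /= E walk_cat.
case: l p0 wp {E} => //= a l _ _ /andP[_].
by case: l' q0 wq => //= b l' _ /andP[/eqP-> _] /andP[/eqP->].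
Qed.

(** * Maximal paths as maximal chains *)

Lemma represents_eq w m : ~ I (of_path k m) -> represents I w m -> w = m.
Proof.
move=> nm; have [//|wm /mem_zero_supp] := eqVneq w m.
move=> /(_ m) z; case: nm; apply/mem_of_path/z.
(* For [w] different from [m], the coefficient of [m] in the difference is [-1], so [m] lies in the
   support. *)
rewrite -mcoeff_neq0 unlock mcoeffB !mcoeffU eqxx (negbTE wm) mulr0n sub0r.
by rewrite oppr_eq0 oner_eq0.
Qed.

Lemma maximal_pathE m : arrows m != [::] ->
  maximal_path I m <-> maxchain nonzero_pair (arrows m).
Proof.
move=> m0; rewrite /maximal_path /maxchain.
have Imul_l c : I (of_arrow k c * of_path k m) <->
    ~~ sorted nonzero_pair (c :: arrows m) by apply: mem_mul_of_path.
have Imul_r c : I (of_path k m * of_arrow k c) <->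
    ~~ sorted nonzero_pair (rcons (arrows m) c).
  by rewrite -cats1; apply: mem_mul_of_path.
have -> : (~ I (of_path k m)) = sorted nonzero_pair (arrows m).
  by apply/propext; rewrite mem_of_path; split=> [/negP/negPn//|->].
have split_l c : sorted nonzero_pair (arrows m) ->
    I (of_arrow k c * of_path k m) <-> ~~ nonzero_pair c (head c (arrows m)).
  by rewrite Imul_l; case: (arrows m) m0 => //= a l _ ->; rewrite andbT.
have split_r c : sorted nonzero_pair (arrows m) ->
    I (of_path k m * of_arrow k c) <-> ~~ nonzero_pair (last c (arrows m)) c.
  rewrite Imul_r; case: (arrows m) m0 => //= a l _.
  by rewrite rcons_path => ->.
have dE := dead_endE nonzero_pair m0; have dE' := dead_end_revE nonzero_pair m0.
split=> -[sm d d']; split=> //.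
- by apply/dE => c; apply/(split_r c sm).
- by apply/dE' => c; apply/(split_l c sm).
- by move=> c; apply/(split_l c sm); move/dE': d'.
- by move=> c; apply/(split_r c sm); move/dE: d.
Qed.

Lemma UMP_maxchain : UMP I <->
  forall s s' a, maxchain nonzero_pair s -> maxchain nonzero_pair s' ->
    a \in s -> a \in s' -> s = s'.
Proof.
split=> [ump s s' a ms ms' sa sa'|inj m m' mm mm' nmm' w w'].
  have nil_in (l : seq (arrow Q)) : a \in l -> l != [::] by case: l.
  have [s0 s0'] := (nil_in _ sa, nil_in _ sa').
  have [m mE] : exists m, arrows m = s by apply: chain_path => //; case: ms.
  have [m' mE'] : exists m, arrows m = s' by apply: chain_path => //; case: ms'.
  rewrite -mE -mE' in ms ms' s0 s0' sa sa' *.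
  have mm : maximal_path I m by apply/maximal_pathE.
  have mm' : maximal_path I m' by apply/maximal_pathE.
  have [->//|nm] := eqVneq m m'.
  have rep r : represents I r r by rewrite /represents subrr; case: Iideal.
  have nr : ~ represents I m m'.
    by case: mm' => nm' _ _ /(represents_eq nm') /eqP; rewrite (negbTE nm).
  (* The shared arrow is itself a nontrivial common subpath. *)
  case: (ump m m' mm mm' nr m m' (rep m) (rep m') (arrow_path a)) => //.
  by split; apply: subpath_arrow.
case: (mm) (mm') => nm _ _ [nm' _ _].
move=> /(represents_eq nm)-> /(represents_eq nm')-> u u0 [um um'].
(* An arrow of [u] lies on both maximal paths, so neither is trivial and both correspond to maximal
   chains. *)
case E: (arrows u) u0 => [|a l]; first by rewrite /plength E.
have au : a \in arrows u by rewrite E mem_head.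
have [am am'] := (subpath_arrows um au, subpath_arrows um' au).
have m0 : arrows m != [::] by case: (arrows m) am.
have m0' : arrows m' != [::] by case: (arrows m') am'.
case: nmm'; suff -> : m = m' by rewrite /represents subrr; case: Iideal.
by apply: arrows_inj => //; apply: inj am am'; apply/maximal_pathE.
Qed.

End Monomial.

(** * Admissibility and the special multiserial condition *)

Lemma admissible_bounded_chains : admissible I -> quadratic_monomial I ->
  bounded_chains nonzero_pair.
Proof.
move=> [Iid [n n2 [In _]]] Iquad; exists n => s ss; rewrite ltnNge.
apply/negP => ns; have s0 : s != [::] by case: s ns {ss} => //; case: n n2 {In}.
have [p pE] := chain_path Iid s0 ss.
(* Length at least [n] puts [p] in the [n]-th power of the arrow ideal, hence in [I], which no chain
   allows. *)
have /(mem_of_path Iid Iquad) : I (of_path k p).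
  by apply/In/of_path_ideal_pow; rewrite /plength pE.
by rewrite pE ss.
Qed.

Lemma special_multiserialE : special_multiserial I <->
  functional nonzero_pair /\ functional (fun a b => nonzero_pair b a).
Proof.
split=> [sp|[f f'] a].
  by split=> a b b' /asboolP + /asboolP; [apply: (sp a).1|apply: (sp a).2].
by split=> b b' /asboolP + /asboolP; [apply: f|apply: f'].
Qed.

End QuadraticMonomial.

Theorem theorem3p2 (k : closedFieldType) (Q : quiver)
  (I R : path_algebra k Q -> Prop)
  (Qconnected : connected_quiver Q)
  (Iadmissible : admissible I)
  (Iquadratic : quadratic_monomial I)
  (Rminimal : minimal_relations R I) :
  UMP I <-> special_multiserial I.
Proof.
have [Iideal _] := Iadmissible.
rewrite UMP_maxchain // special_multiserialE.
exact/maxchain_inj_functional/admissible_bounded_chains.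
Qed.
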